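(* $\le_T^{RS}\neq \le_T^{O}$ (as sets of pairs $(A,B)$ with $A\le B$).
   Context: An NPTM is a nondeterministic oracle Turing machine $N$ each of whose computation paths ends in one of three outcomes $\mathbf{acc}$, $\mathbf{rej}$, $\mathbf{?}$, such that there is a polynomial $p$ with: for every oracle $D$ and every input $x$, every computation path of $N^D(x)$ has length at most $p(|x|)$. For an oracle $D$ and input $x$, let $out_{N^D}(x)$ be the set of outcomes occurring on some path of $N^D(x)$; $L(N^D)=\{x:\mathbf{acc}\in out_{N^D}(x)\}$. $N^D(x)$ is underproductive if $\{\mathbf{acc},\mathbf{rej}\}\not\subseteq out_{N^D}(x)$, and overproductive if $out_{N^D}(x)\neq\{\mathbf{?}\}$; $N^D$ is underproductive (overproductive) if $N^D(x)$ is so for every $x$. $N$ is robustly underproductive (overproductive) if $N^D$ is underproductive (overproductive) for every oracle $D$. $A\le_T^{SN}B$ if there is an NPTM $N$ with $N^B$ both overproductive and underproductive and $A=L(N^B)$. $A\le_T^{RS}B$ if $A\le_T^{SN}B$ via an $N$ that is both robustly overproductive and robustly underproductive. $A\le_T^{O}B$ if $A\le_T^{SN}B$ via an $N$ that is robustly overproductive. *)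

(* Defs.v *)
From HB Require Import structures.
From mathcomp Require Import all_boot all_order all_algebra.
From mathcomp Require Import boolp classical_sets.

Set Implicit Arguments.
Unset Strict Implicit.
Unset Printing Implicit Defensive.

Local Open Scope classical_set_scope.

Definition language := set (seq bool).

Inductive outcome := Acc | Rej | Unknown.

Definition bool_of_outcome (o : outcome) : option bool :=
  match o with Acc => Some true | Rej => Some false | Unknown => None end.
Definition outcome_of_bool (b : option bool) : outcome :=
  match b with Some true => Acc | Some false => Rej | None => Unknown end.
Lemma bool_of_outcomeK : cancel bool_of_outcome outcome_of_bool.
Proof. by case. Qed.
HB.instance Definition _ := Finite.copy outcome (can_type bool_of_outcomeK).

Inductive direction := MoveLeft | Stay | MoveRight.

Definition bool_of_direction (d : direction) : option bool :=
  match d with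
  | MoveLeft => Some false | Stay => None | MoveRight => Some true
  end.
Definition direction_of_bool (b : option bool) : direction :=
  match b with
  | Some false => MoveLeft | None => Stay | Some true => MoveRight
  end.
Lemma bool_of_directionK : cancel bool_of_direction direction_of_bool.
Proof. by case. Qed.
HB.instance Definition _ :=
  Finite.copy direction (can_type bool_of_directionK).

(* [None] is the blank; besides the two bits there are m auxiliary symbols. *)
Definition symbol (m : nat) : Type := option (bool + 'I_m).

(* A tape, infinite in both directions: the cells to the left of the head      *)
(* (nearest first), and the scanned cell followed by those to its right. Cells *)
(* beyond the ends of the two lists are blank.                                 *)
Definition tape (m : nat) : Type := (seq (symbol m) * seq (symbol m))%type.

Definition tape_read m (t : tape m) : symbol m := head None t.2.

Definition tape_write m (a : symbol m) (t : tape m) : tape m :=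
  (t.1, a :: behead t.2).

Definition tape_move m (d : direction) (t : tape m) : tape m :=
  match d with
  | MoveLeft => (behead t.1, head None t.1 :: t.2)
  | Stay => t
  | MoveRight => (head None t.2 :: t.1, behead t.2)
  end.

(* What a step does: the next state, or the outcome with which the path ends;  *)
(* on each of the k.+1 tapes, the symbol written and the head movement; and    *)
(* the bit, if any, appended to the query tape.                                *)
Definition action (s k m : nat) : Type :=
  (('I_s + outcome) * {ffun 'I_k.+1 -> symbol m * direction}
   * option bool)%type.

(* A nondeterministic oracle Turing machine with a write-only query tape. In   *)
(* state [ask] the transition relation is not consulted: the oracle answers    *)
(* whether the word on the query tape belongs to it, the next state is [yes]   *)
(* or [no] accordingly, and the query tape is erased.                          *)
Record notm := NOTM {
  nstates : nat;
  ntapes : nat;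
  naux : nat;
  start : 'I_nstates;
  ask : 'I_nstates;
  yes : 'I_nstates;
  no : 'I_nstates;
  delta : 'I_nstates -> {ffun 'I_ntapes.+1 -> symbol naux} ->
          {set action nstates ntapes naux}
}.

(* The control state (or the outcome, once halted), the tapes, and the word    *)
(* on the query tape.                                                          *)
Definition config (N : notm) : Type :=
  (('I_(nstates N) + outcome) * {ffun 'I_(ntapes N).+1 -> tape (naux N)}
   * seq bool)%type.

Definition control N (c : config N) := c.1.1.
Definition tapes N (c : config N) := c.1.2.
Definition query N (c : config N) := c.2.

Definition init (N : notm) (x : seq bool) : config N :=
  (inl (start N),
   [ffun i => if i == ord0 then ([::], [seq Some (inl b) | b <- x])
              else ([::], [::])],
   [::]).

Definition scan N (c : config N) : {ffun 'I_(ntapes N).+1 -> symbol (naux N)} :=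
  [ffun i => tape_read (tapes c i)].

Definition act N (a : action (nstates N) (ntapes N) (naux N)) (c : config N) :
    config N :=
  (a.1.1,
   [ffun i => tape_move (a.1.2 i).2 (tape_write (a.1.2 i).1 (tapes c i))],
   if a.2 is Some b then rcons (query c) b else query c).

Definition successors N (D : language) (c : config N) : seq (config N) :=
  match control c with
  | inr _ => [::]
  | inl q =>
      if q == ask N then
        [:: (inl (if query c \in D then yes N else no N), tapes c, [::])]
      else [seq act a c | a <- enum (delta q (scan c))]
  end.

Definition step N (D : language) : rel (config N) :=
  fun c c' => c' \in successors D c.

(* [p] lists the configurations, after the initial one, of a possibly          *)
(* incomplete computation path of N^D(x) with [size p] steps.                  *)
Definition run N (D : language) (x : seq bool) (p : seq (config N)) : bool :=
  path (step D) (init N x) p.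

Definition final N (x : seq bool) (p : seq (config N)) : config N :=
  last (init N x) p.

Definition NPTM (N : notm) : Prop :=
  (forall D x (p : seq (config N)), run D x p ->
     successors D (final x p) = [::] ->
     exists o : outcome, control (final x p) = inr o) /\
  (exists P : {poly nat}, forall D x (p : seq (config N)), run D x p ->
     (size p <= P.[size x]%R)%N).

Definition out (N : notm) (D : language) (x : seq bool) : set outcome :=
  [set o | exists2 p : seq (config N), run D x p & control (final x p) = inr o].

Definition lang (N : notm) (D : language) : language :=
  [set x | out N D x Acc].

Definition underproductive (N : notm) (D : language) : Prop :=
  forall x, ~ ([set Acc; Rej] `<=` out N D x).

Definition overproductive (N : notm) (D : language) : Prop :=
  forall x, out N D x <> [set Unknown].

Definition robustly_underproductive (N : notm) : Prop :=
  forall D, underproductive N D.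

Definition robustly_overproductive (N : notm) : Prop :=
  forall D, overproductive N D.

Definition SN_via (N : notm) (A B : language) : Prop :=
  [/\ NPTM N, overproductive N B, underproductive N B & A = lang N B].

Definition le_SN : set (language * language) :=
  [set AB | exists N, SN_via N AB.1 AB.2].

Definition le_RS : set (language * language) :=
  [set AB | exists N, [/\ SN_via N AB.1 AB.2,
                          robustly_overproductive N &
                          robustly_underproductive N]].

Definition le_O : set (language * language) :=
  [set AB | exists2 N, SN_via N AB.1 AB.2 & robustly_overproductive N].

(* Main.v *)
From HB Require Import structures.
From mathcomp Require Import all_boot all_order all_algebra.
From mathcomp Require Import boolp classical_sets zify.
Require Import Defs.

(**
A level-n node is a pair (u, p) of bit strings with |u| = n and |p| <= n; an
oracle D makes it active when D contains its code. A violation at the block u is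
one of the following local defects:
- (u, p) is active with |p| < n, but both (u, p0) and (u, p1) are inactive;
- (u, p) is active with |p| = n, and either p <= u or the root (p, empty) of the
  next block is inactive;
- u = 0 and its root is inactive.
Following active nodes from the root of block 0 through ever larger blocks, one
gets stuck somewhere, so each oracle has a violation at each level. The machine
[guesser] guesses a violation, verifies it with at most three queries and
answers with the lowest bit of u: it is robustly overproductive, and underproductive
on every oracle whose violations at each level carry the same bit.

A robustly over- and underproductive machine M computes, on each input, a total
function of the oracle with polynomial-size certificates for both answers. An
adversary maintains an oracle whose only violation is at an untouched block u; when
u has to be revealed, it moves the violation to a fresh larger block, whose lowest bit
it may choose. Certificates for opposite answers conflict outside the revealed
blocks, so revealing the blocks met by one certificate for "accept" shortens all
those for "reject"; after polynomially many steps this is absurd. Hence M errs on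
some such oracle, and these oracles, one level for each M, are combined into a
single one.
*)

Set Implicit Arguments.
Unset Strict Implicit.
Unset Printing Implicit Defensive.

(** * Computations of a machine *)

Section Outcomes.
Variables (N : notm) (D : language).
Implicit Types (c : config N) (S : outcome -> Prop).

(** Demanding a successor wherever the machine has not halted rules out paths that die without an
    outcome, so both clauses of [NPTM] come from one induction on [b]. *)
Fixpoint bounded (b : nat) c : Prop :=
  (exists o, control c = inr o) \/
  if b is b'.+1 then
    successors D c <> [::] /\ forall c', step D c c' -> bounded b' c'
  else False.

Definition reaches c (o : outcome) : Prop :=
  exists2 p, path (step D) c p & control (last c p) = inr o.

Definition computes (b : nat) c S : Prop :=
  bounded b c /\ forall o, reaches c o <-> S o.

Lemma successors_halted c o : control c = inr o -> successors D c = [::].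
Proof. by rewrite /successors => ->. Qed.

Lemma bounded_le b b' c : b <= b' -> bounded b c -> bounded b' c.
Proof.
elim: b b' c => [|b IH] [|b'] c //= le [[o h]|]; try by left; exists o.
- by [].
- case=> h1 h2; right; split=> // c' /h2; exact: IH.
Qed.

Lemma bounded_path b c p :
  bounded b c -> path (step D) c p ->
  size p <= b /\
  (successors D (last c p) = [::] -> exists o, control (last c p) = inr o).
Proof.
have halted (d : config N) q o : control d = inr o -> path (step D) d q -> q = [::].
  by move=> h; case: q => //= d' q; rewrite /step (successors_halted h).
elim: b c p => [|b IH] c p /=.
  case=> [[o h]|//] /(halted _ _ _ h) ->; split=> //= _; by exists o.
case=> [[o h] /(halted _ _ _ h) ->|[h1 h2]]; first by split=> //= _; exists o.
case: p => [|c' p] /= ; first by split.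
by case/andP=> /h2 /IH /[apply].
Qed.

Lemma computes_ext b c S S' :
  (forall o, S o <-> S' o) -> computes b c S -> computes b c S'.
Proof. by move=> e [h1 h2]; split=> // o; rewrite h2. Qed.

Lemma computes_le b b' c S : b <= b' -> computes b c S -> computes b' c S.
Proof. by move=> le [h1 h2]; split=> //; apply: bounded_le h1. Qed.

Lemma computes_halted b c o : control c = inr o -> computes b c (eq o).
Proof.
move=> h; split; first by case: b => [|b]; left; exists o.
move=> o'; split=> [[[|c' p]] /=|<-].
- by rewrite h => _ [].
- by rewrite /step (successors_halted h).
- by exists [::].
Qed.

Lemma computes_step b c (S : config N -> outcome -> Prop) :
  successors D c <> [::] ->
  (forall c', c' \in successors D c -> computes b c' (S c')) ->
  computes b.+1 c (fun o => exists2 c', c' \in successors D c & S c' o).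
Proof.
move=> ne h; split.
  by right; split=> // c' /h [].
move=> o; split.
  case=> [[|c' p] /=].
    by move=> _ /successors_halted.
  case/andP=> s1 p1 e; exists c' => //.
  by have [_ /(_ o) [h1 _]] := h _ s1; apply: h1; exists p.
case=> c' s1; have [_ /(_ o) [_ h1]] := h _ s1 => /h1 [p p1 e].
by exists (c' :: p) => //=; rewrite p1 andbT.
Qed.

Lemma computes_step1 b c c' S :
  successors D c = [:: c'] -> computes b c' S -> computes b.+1 c S.
Proof.
move=> e h; apply: computes_ext (computes_step (S := fun=> S) _ _).
- move=> o; split=> [[]//|s]; exists c' => //; by rewrite e inE.
- by rewrite e.
- by move=> d; rewrite e inE => /eqP ->.
Qed.

End Outcomes.

(** * The guessing machine *)

(* [Interior]: p is being guessed along with u; [Settled]: p has ended before u;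
   [Full f s]: |p| = |u|, with f the claim that u < p and s the comparison so far
   (None for equality); [Origin]: the root of block 0. *)
Inductive guess_state :=
  Interior | Settled | Full of bool & option bool | Origin.
Inductive state := Start | Guess of guess_state | Emit | Ask | Answer of bool.

Definition guess_code g : option (option (option (bool * option bool))) :=
  match g with
  | Interior => None
  | Settled => Some None
  | Origin => Some (Some None)
  | Full b s => Some (Some (Some (b, s)))
  end.
Definition guess_decode x :=
  match x with
  | None => Interior
  | Some None => Settled
  | Some (Some None) => Origin
  | Some (Some (Some (b, s))) => Full b s
  end.
Lemma guess_codeK : cancel guess_code guess_decode.
Proof. by case. Qed.
HB.instance Definition _ := Finite.copy guess_state (can_type guess_codeK).

Definition state_code s : option (option (option (bool + guess_state))) :=
  match s with
  | Start => None
  | Emit => Some None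
  | Ask => Some (Some None)
  | Answer b => Some (Some (Some (inl b)))
  | Guess g => Some (Some (Some (inr g)))
  end.
Definition state_decode x :=
  match x with
  | None => Start
  | Some None => Emit
  | Some (Some None) => Ask
  | Some (Some (Some (inl b))) => Answer b
  | Some (Some (Some (inr g))) => Guess g
  end.
Lemma state_codeK : cancel state_code state_decode.
Proof. by case=> //= g. Qed.
HB.instance Definition _ := Finite.copy state (can_type state_codeK).

(** One position of a node: a bit of u, and the aligned bit of p or [None] where p has no bit. Three
    bits per letter make [code] injective. *)
Definition letter : Type := (bool * option bool)%type.
Definition bits (a : letter) : seq bool :=
  [:: a.1; isSome a.2; odflt false a.2].
Definition code (z : seq letter) : seq bool := flatten [seq bits a | a <- z].

(** In this order: a mark, the two bits left of a letter whose first bit has been emitted, and a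
    whole letter. A letter thus fits in one cell and is consumed bit by bit. *)
Definition aux : Type := (bool + (bool * bool + bool * bool * bool))%type.
Definition sym : Type := symbol #|{: aux}|.
Definition saux (a : aux) : sym := Some (inr (enum_rank a)).
Definition mark (e : bool) : sym := saux (inl e).
Definition sbits (a : letter) : sym :=
  saux (inr (inr (a.1, isSome a.2, odflt false a.2))).

(* The next bit of a symbol and its remainder ([None] once it is exhausted); marks
   emit nothing. *)
Definition emission (s : sym) : option (bool * sym) :=
  match s with
  | Some (inl c) => Some (c, None)
  | Some (inr k) =>
      match enum_val k with
      | inl e => None
      | inr (inl (b, c)) => Some (b, Some (inl c))
      | inr (inr (a, b, c)) => Some (a, saux (inr (inl (b, c))))
      end
  | None => None
  end.

Arguments emission : simpl never.

(** A bit of u, a bit of p, and a flag telling that p has ended. The most significant bits are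
    guessed first. *)
Definition guess : Type := (bool * bool * bool)%type.

(** The first difference is the most significant one and decides; [Some true] stands for u < p. *)
Definition compare_step (s : option bool) (a b : bool) : option bool :=
  if s is None then if a == b then None else Some b else s.

Definition next_guess (g : guess_state) (ch : guess) : guess_state :=
  let: (a, b, c) := ch in
  match g with
  | Interior => if c then Settled else Interior
  | Full f s => Full f (compare_step s a b)
  | _ => g
  end.

(** Where p ends, tape 1 gets no bit of p while tapes 2 and 3 get 0 and 1, which extend p to its two
    children. In a [Full] state tape 2 holds the root of block p, so the bits of p become first
    components there. *)
Definition guess_letter (g : guess_state) (ch : guess) (i : nat) : letter :=
  let: (a, b, c) := ch in
  match g with
  | Interior =>
      if c then (a, match i with 1 => None | 2 => Some false | _ => Some true end)
      else (a, Some b)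
  | Settled => (a, None)
  | Full _ _ => if i == 1 then (a, Some b) else (b, None)
  | Origin => (false, None)
  end.

(* Tapes 1, 2 and 3 receive the nodes to be queried, above a mark recording the
   answer that each query must get; [None] is for a tape that is not used. *)
Definition expected (g : guess_state) (i : nat) : option bool :=
  match g, i with
  | (Interior | Settled), 1 => Some true
  | (Interior | Settled), (2 | 3) => Some false
  | Full _ _, 1 => Some true
  | Full true _, 2 => Some false
  | Origin, 1 => Some false
  | _, _ => None
  end.

Definition guess_bit (g : guess_state) (ch : guess) : bool :=
  if g is Origin then false else ch.1.1.

(** [Interior] is refused because p then has full length; in a [Full] state the initial claim must
    match the comparison. *)
Definition accepting (g : guess_state) : bool :=
  match g with
  | Settled | Origin => true
  | Full f s => (s == Some true) == f
  | Interior => false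
  end.

Definition guess_symbol (g : guess_state) (ch : guess) (i : 'I_4) : sym :=
  if i == ord0 then Some (inl (guess_bit g ch))
  else if expected g i is Some _ then sbits (guess_letter g ch i) else None.

Definition mark_symbol (g : guess_state) (i : 'I_4) : sym :=
  if expected g i is Some e then mark e else None.

Definition starts : {set guess_state} :=
  [set g in [:: Interior; Full true None; Full false None; Origin]].

Definition act_t := action #|{: state}| 3 #|{: aux}|.
Definition goto (s : state) : 'I_#|{: state}| + outcome := inl (enum_rank s).
Definition scan_t := {ffun 'I_4 -> sym}.

Definition start_action (v : scan_t) (g : guess_state) : act_t :=
  (goto (Guess g),
   [ffun i => if i == ord0 then (v i, Stay) else (mark_symbol g i, MoveRight)],
   None).

Definition guess_action (g : guess_state) (ch : guess) : act_t :=
  (goto (Guess (next_guess g ch)),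
   [ffun i => (guess_symbol g ch i, MoveRight)], None).

(** After the move to the left, head 0 scans the lowest bit of u, which decides the answer; on the
    empty input it scans a blank, which counts as 0. *)
Definition end_action (g : guess_state) : act_t :=
  (if accepting g then goto Emit else inr Unknown,
   [ffun i => (None, MoveLeft)], None).

(** Tapes are queried one after the other, and a tape reads blank once it has passed its query, so
    no state has to remember which one is in progress. *)
Definition select (v : 'I_4 -> sym) : option 'I_4 :=
  [pick i | (i != ord0) && (v i != None)].

Definition keep (v : scan_t) (s : 'I_#|{: state}| + outcome) : act_t :=
  (s, [ffun i => (v i, Stay)], None).

Definition emit_action (v : scan_t) : act_t :=
  if select v is Some i then
    if emission (v i) is Some (b, s) then
      (goto Emit,
       [ffun j => if j == i then (s, if s == None then MoveLeft else Stay)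
                  else (v j, Stay)], Some b)
    else keep v (goto Ask)
  else keep v (inr (if v ord0 == Some (inl true) then Acc else Rej)).

Definition answer_action (b : bool) (v : scan_t) : act_t :=
  if select v is Some i then
    if v i == mark b then
      (goto Emit, [ffun j => if j == i then (None, Stay) else (v j, Stay)], None)
    else keep v (inr Unknown)
  else keep v (inr Unknown).

Definition transitions (q : 'I_#|{: state}|) (v : scan_t) : {set act_t} :=
  match enum_val q with
  | Start => [set start_action v g | g in starts]
  | Guess g =>
      if v ord0 == None then [set end_action g]
      else [set guess_action g ch | ch in {: guess}]
  | Emit => [set emit_action v]
  | Ask => finset.set0
  | Answer b => [set answer_action b v]
  end.

Definition guesser : notm :=
  @NOTM #|{: state}| 3 #|{: aux}| (enum_rank Start) (enum_rank Ask)
    (enum_rank (Answer true)) (enum_rank (Answer false)) transitions.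

(** * Runs of the guesser *)

Definition cfg := config guesser.
Definition tp := tape #|{: aux}|.
Definition mkcfg (s : 'I_#|{: state}| + outcome) (T : {ffun 'I_4 -> tp})
  (q : seq bool) : cfg := (s, T, q).

Lemma emission_saux a : emission (saux a) =
  match a with
  | inl e => None
  | inr (inl (b, c)) => Some (b, Some (inl c))
  | inr (inr (a, b, c)) => Some (a, saux (inr (inl (b, c))))
  end.
Proof. by rewrite /emission /saux /= enum_rankK. Qed.

Lemma mark_inj : injective mark.
Proof. by move=> a b [] /enum_rank_inj []. Qed.

(* A nonempty right-hand list makes rewriting the scanned symbol the identity. *)
Definition holds (t : tp) (k : seq sym) : Prop :=
  exists r, t = (behead k, head None k :: r).

Definition represents (T : {ffun 'I_4 -> tp}) (K : 'I_4 -> seq sym) : Prop :=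
  forall i, holds (T i) (K i).

Definition update (K : 'I_4 -> seq sym) i k := fun j => if j == i then k else K j.

Lemma holds_read t k : holds t k -> tape_read t = head None k.
Proof. by case=> r ->. Qed.

Lemma holds_keep t k : holds t k -> tape_write (tape_read t) t = t.
Proof. by case=> r ->. Qed.

Lemma successors_ask D T q :
  successors D (mkcfg (goto Ask) T q) =
  [:: mkcfg (goto (Answer (q \in D))) T [::]].
Proof. by rewrite /successors /= eqxx; case: (q \in D). Qed.

Lemma successors_transitions D s T q : s != Ask ->
  successors D (mkcfg (goto s) T q) =
  [seq @act guesser a (mkcfg (goto s) T q)
     | a <- enum (transitions (enum_rank s) (scan (mkcfg (goto s) T q)))].
Proof.
move=> ne; rewrite /successors /=.
by rewrite (inj_eq (@enum_rank_inj _)) (negbTE ne).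
Qed.

Lemma keep_act T K q s s' : represents T K ->
  @act guesser (keep (scan (mkcfg s T q)) s') (mkcfg s T q) = mkcfg s' T q.
Proof.
move=> h; congr (_, _, _); apply/ffunP=> i; rewrite !ffunE /=.
exact: holds_keep (h i).
Qed.

Lemma select_scan T K q s : represents T K ->
  select (scan (mkcfg s T q)) = select (fun i => head None (K i)).
Proof.
move=> h; apply: eq_pick => i /=; rewrite ffunE /tapes /=.
by rewrite (holds_read (h i)).
Qed.

Lemma scanE T K q s i : represents T K ->
  scan (mkcfg s T q) i = head None (K i).
Proof. by move=> h; rewrite ffunE (holds_read (h i)). Qed.

Lemma select_update K i k : select (fun i => head None (K i)) = Some i ->
  head None k != None ->
  select (fun j => head None (update K i k j)) = Some i.
Proof.
move=> h n; rewrite -h; apply: eq_pick => j /=; rewrite /update.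
case: (j =P i) => // ->; move: h; rewrite /select; case: pickP => // i' /andP [_ e] [<-].
by rewrite n e.
Qed.

Section Checking.
Variable D : language.

Lemma emit_step T K q i b s k b' S :
  represents T K -> select (fun i => head None (K i)) = Some i ->
  K i = s :: k -> emission s = Some (b, None) ->
  (forall T', represents T' (update K i k) ->
     computes D b' (mkcfg (goto Emit) T' (rcons q b)) S) ->
  computes D b'.+1 (mkcfg (goto Emit) T q) S.
Proof.
move=> rT sel Ki em hS.
pose T' : {ffun 'I_4 -> tp} :=
  [ffun j => if j == i then tape_move MoveLeft (tape_write None (T i)) else T j].
apply: (@computes_step1 _ _ _ _ (mkcfg (goto Emit) T' (rcons q b))).
  rewrite successors_transitions // /transitions enum_rankK enum_set1 /=.
  rewrite /emit_action (select_scan _ _ rT) sel (scanE _ _ _ rT) Ki /= em /=.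
  congr [:: (_, _, _)]; apply/ffunP => j; rewrite !ffunE /=.
  case: eqP => [-> //|_]; exact: holds_keep (rT j).
apply: hS => j; rewrite /update ffunE; case: eqP => [_|_]; last exact: rT.
by case: (rT i) => r ->; rewrite Ki /=; case: (k) => [|? ?] /=; eexists.
Qed.

Lemma emit_rewrite T K q i b s s' k b' S :
  represents T K -> select (fun i => head None (K i)) = Some i ->
  K i = s :: k -> emission s = Some (b, s') -> s' != None ->
  (forall T', represents T' (update K i (s' :: k)) ->
     computes D b' (mkcfg (goto Emit) T' (rcons q b)) S) ->
  computes D b'.+1 (mkcfg (goto Emit) T q) S.
Proof.
move=> rT sel Ki em ns hS.
pose T' : {ffun 'I_4 -> tp} :=
  [ffun j => if j == i then tape_write s' (T i) else T j].
apply: (@computes_step1 _ _ _ _ (mkcfg (goto Emit) T' (rcons q b))).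
  rewrite successors_transitions // /transitions enum_rankK enum_set1 /=.
  rewrite /emit_action (select_scan _ _ rT) sel (scanE _ _ _ rT) Ki /= em /=.
  rewrite (negbTE ns).
  congr [:: (_, _, _)]; apply/ffunP => j; rewrite !ffunE /=.
  case: eqP => [-> //|_]; exact: holds_keep (rT j).
apply: hS => j; rewrite /update ffunE; case: eqP => [_|_]; last exact: rT.
by case: (rT i) => r ->; rewrite Ki /=; eexists.
Qed.

Lemma represents_ext T K K' : K =1 K' -> represents T K -> represents T K'.
Proof. by move=> e h i; rewrite -e. Qed.

Lemma updateK K i k k' : update (update K i k) i k' =1 update K i k'.
Proof. by move=> j; rewrite /update; case: eqP. Qed.

Lemma select_head K i : select (fun i => head None (K i)) = Some i ->
  i != ord0 /\ head None (K i) != None.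
Proof. by rewrite /select; case: pickP => // i' /andP [h1 h2] [<-]. Qed.

(** Induction on the letters left, with [q] the word emitted so far. A letter takes three steps, one
    per bit; the mark takes three more: entering [Ask], the reply of the oracle, and its comparison
    with the mark. *)
Lemma check_tape T K q i l e b S :
  represents T K -> select (fun i => head None (K i)) = Some i ->
  K i = map sbits l ++ [:: mark e] ->
  ((q ++ code l \in D) = e ->
   forall T', represents T' (update K i [::]) ->
     computes D b (mkcfg (goto Emit) T' [::]) S) ->
  computes D (b + (3 * size l + 3)) (mkcfg (goto Emit) T q)
    (if (q ++ code l \in D) == e then S else eq Unknown).
Proof.
elim: l T K q => [|a l IH] T K q rT sel Ki hS.
  rewrite /= muln0 add0n addn3 cats0 in hS *.
  apply: (@computes_step1 _ _ _ _ (mkcfg (goto Ask) T q)).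
    rewrite successors_transitions // /transitions enum_rankK enum_set1 /=.
    rewrite /emit_action (select_scan _ _ rT) sel (scanE _ _ _ rT) Ki /=.
    by rewrite /mark emission_saux (keep_act _ _ _ rT).
  apply: computes_step1 (successors_ask _ _ _) _.
  case: eqP => ans.
    pose T' : {ffun 'I_4 -> tp} :=
      [ffun j => if j == i then tape_write None (T i) else T j].
    apply: (@computes_step1 _ _ _ _ (mkcfg (goto Emit) T' [::])).
      rewrite successors_transitions // /transitions enum_rankK enum_set1 /=.
      rewrite /answer_action (select_scan _ _ rT) sel (scanE _ _ _ rT) Ki /=.
      rewrite ans eqxx.
      congr [:: (_, _, _)]; apply/ffunP => j; rewrite !ffunE /=.
      case: eqP => [-> //|_]; exact: holds_keep (rT j).
    apply: hS => // j; rewrite /update ffunE; case: eqP => [_|_]; last exact: rT.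
    by case: (rT i) => r ->; rewrite Ki /=; eexists.
  apply: (@computes_step1 _ _ _ _ (mkcfg (inr Unknown) T [::])).
    rewrite successors_transitions // /transitions enum_rankK enum_set1 /=.
    rewrite /answer_action (select_scan _ _ rT) sel (scanE _ _ _ rT) Ki /=.
    rewrite (inj_eq mark_inj) eq_sym (introF eqP ans) (keep_act _ _ _ rT) //.
  exact: computes_halted.
have -> : b + (3 * size (a :: l) + 3) = (b + (3 * size l + 3)).+3.
  by rewrite /= mulnS; lia.
have -> : q ++ code (a :: l) =
   rcons (rcons (rcons q a.1) (isSome a.2)) (odflt false a.2) ++ code l.
  by rewrite -!cats1 /code /= -!catA.
apply: (emit_rewrite rT sel Ki); first by rewrite /sbits emission_saux.
  by [].
move=> T1 r1.
have sel1 := select_update sel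
  (k := saux (inr (inl (isSome a.2, odflt false a.2))) :: map sbits l ++ [:: mark e]) isT.
apply: (emit_rewrite r1 sel1); first by rewrite /update eqxx.
- by rewrite emission_saux.
- by [].
move=> T2 r2.
have {}r2 := represents_ext (updateK _ _ _ _) r2.
have sel2 := select_update sel
  (k := Some (inl (odflt false a.2)) :: map sbits l ++ [:: mark e]) isT.
apply: (emit_step r2 sel2); first by rewrite /update eqxx.
  by [].
move=> T3 r3.
have {}r3 := represents_ext (updateK _ _ _ _) r3.
have sel3 : select (fun j => head None (update K i (map sbits l ++ [:: mark e]) j)) =
    Some i.
  by apply: (select_update sel); case: (l).
apply: (IH _ _ _ r3 sel3); first by rewrite /update eqxx.
move=> ans T4 /(represents_ext (updateK _ _ _ _)); apply: hS.
by rewrite -ans -!cats1 /code /= -!catA.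
Qed.

End Checking.

Definition check (D : language) (x : option (seq letter * bool)) : bool :=
  if x is Some (l, e) then (code l \in D) == e else true.

Definition label (k : seq sym) : outcome :=
  if head None k == Some (inl true) then Acc else Rej.

(** Induction on the number [k] of tapes in use: a tape that passes its query is dropped from
    [L]. *)
Lemma check_tapes D n k (L : 'I_4 -> option (seq letter * bool)) T K :
  (forall i, i != ord0 ->
     if L i is Some (l, e) then K i = map sbits l ++ [:: mark e] /\ size l = n
     else head None (K i) = None) ->
  represents T K -> #|[pred i | (i != ord0) && (L i != None)]| <= k ->
  computes D (k * (3 * n + 3) + 1) (mkcfg (goto Emit) T [::])
    (eq (if [forall i, (i != ord0) ==> check D (L i)] then label (K ord0)
         else Unknown)).
Proof.
move=> hL rT; have halt L' K' T' : (forall i, i != ord0 ->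
     if L' i is Some (l, e) then K' i = map sbits l ++ [:: mark e] /\ size l = n
     else head None (K' i) = None) ->
   represents T' K' -> select (fun i => head None (K' i)) = None ->
   computes D 1 (mkcfg (goto Emit) T' [::])
     (eq (if [forall i, (i != ord0) ==> check D (L' i)] then label (K' ord0)
          else Unknown)).
  move=> h r sel; have -> : [forall i, (i != ord0) ==> check D (L' i)].
    apply/forallP=> i; apply/implyP => i0; move: (h i i0).
    case: (L' i) => [[l e]|] //= [Ki _]; move: sel; rewrite /select.
    by case: pickP => // /(_ i); rewrite /= i0 Ki; case: (l).
  apply: (@computes_step1 _ _ _ _ (mkcfg (inr (label (K' ord0))) T' [::])).
    rewrite successors_transitions // /transitions enum_rankK enum_set1 /=.
    rewrite /emit_action (select_scan _ _ r) sel (scanE _ _ _ r).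
    by rewrite (keep_act _ _ _ r).
  exact: computes_halted.
elim: k L K T hL rT => [|k IH] L K T hL rT card.
all: case sel: (select (fun i => head None (K i))) => [i|];
  last by apply: computes_le (leq_addl _ _) _; exact: halt sel.
- have [i0 hi] := select_head sel; move: (hL i i0).
  case Li: (L i) => [[l e]|] h; last by rewrite h in hi.
  by move: card; rewrite leqn0 => /eqP /card0_eq /(_ i); rewrite !inE i0 Li.
- have [i0 hi] := select_head sel; move: (hL i i0).
  case Li: (L i) => [[l e]|] h; last by rewrite h in hi.
  case: h => Ki sl.
  pose L' j := if j == i then None else L j.
  have ch : [forall j, (j != ord0) ==> check D (L j)] =
      ((code l \in D) == e) && [forall j, (j != ord0) ==> check D (L' j)].
    apply/forallP/andP => [h|[h1 /forallP h2] j].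
      split; first by move: (h i); rewrite i0 Li.
      by apply/forallP => j; rewrite /L'; case: (j =P i) => //; rewrite implybT.
    by move: (h2 j); rewrite /L'; case: (j =P i) => // -> _; rewrite i0 Li.
  rewrite mulSn -sl -addnA addnC; apply: computes_ext; last first.
    apply: (@computes_ext _ _ _ _ _ _ _ (check_tape rT sel Ki _)) => [o|_ T' rT'].
      by apply: iff_refl.
    rewrite sl; apply: (IH L') rT' _.
      move=> j j0; rewrite /L' /update; case: (j =P i) => // _; exact: hL.
    move: card; rewrite (cardD1 i) !inE i0 Li /= add1n ltnS => card.
    apply: leq_trans card; apply: subset_leq_card; apply/fintype.subsetP => j.
    by rewrite !inE /L'; case: (j =P i) => // _; rewrite andbF.
  move=> o /=; rewrite ch; case: ((code l \in D) == e) => //=.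
  by rewrite /update eq_sym (negbTE i0).
Qed.

(* Guess sequences are listed with the most recent guess first, as on the
   left-hand part of the tapes. *)
Fixpoint guessed (g : guess_state) (w : seq guess) : guess_state :=
  if w is ch :: w' then next_guess (guessed g w') ch else g.

Fixpoint stack (g : guess_state) (w : seq guess) (i : 'I_4) : seq sym :=
  if w is ch :: w' then guess_symbol (guessed g w') ch i :: stack g w' i
  else if i == ord0 then [::] else [:: mark_symbol g i].

Fixpoint letters (g : guess_state) (w : seq guess) (i : nat) : seq letter :=
  if w is ch :: w' then guess_letter (guessed g w') ch i :: letters g w' i
  else [::].

Definition entry g w i := omap (fun e => (letters g w i, e)) (expected g i).

Definition verdict (D : language) g w : outcome :=
  if accepting (guessed g w) && [forall i : 'I_4, (i != ord0) ==> check D (entry g w i)]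
  then label (stack g w ord0) else Unknown.

Lemma expected_guessed g w i : expected (guessed g w) i = expected g i.
Proof.
by elim: w => //= -[[a b] c] w <-; case: (guessed g w) => //=; case: c.
Qed.

Lemma size_letters g w i : size (letters g w i) = size w.
Proof. by elim: w => //= ? ? ->. Qed.

Lemma stack_letters g w (i : 'I_4) : i != ord0 ->
  if expected g i is Some e then stack g w i = map sbits (letters g w i) ++ [:: mark e]
  else head None (stack g w i) = None.
Proof.
move=> i0; case ex: (expected g i) => [e|]; elim: w => [|ch w IH] /=.
- by rewrite (negbTE i0) /mark_symbol ex.
- by rewrite IH /guess_symbol (negbTE i0) expected_guessed ex.
- by rewrite (negbTE i0) /mark_symbol ex.
- by rewrite /guess_symbol (negbTE i0) expected_guessed ex.
Qed.

Definition guess_tapes g w (r : seq sym) : {ffun 'I_4 -> tp} :=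
  [ffun i => (stack g w i, if i == ord0 then r else [::])].

(** Each guess consumes one input bit, so |u| is the input length; the blank at the head of [r]
    signals the end of the input. *)
Lemma guess_phase D g w (xs : seq bool) r : head None r = None ->
  computes D (size xs + (3 * (3 * (size xs + size w) + 3) + 2))
    (mkcfg (goto (Guess (guessed g w)))
       (guess_tapes g w ([seq Some (inl b) | b <- xs] ++ r)) [::])
    (fun o => exists2 w', size w' = size xs & o = verdict D g (w' ++ w)).
Proof.
move=> hr; elim: xs w => [|x xs IH] w /=.
  rewrite !add0n addn2.
  set T := guess_tapes _ _ _.
  have v0 : scan (mkcfg (goto (Guess (guessed g w))) T [::]) ord0 = None.
    by rewrite !ffunE.
  pose T' : {ffun 'I_4 -> tp} :=
    [ffun i => tape_move MoveLeft (tape_write None (T i))].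
  apply: (@computes_step1 _ _ _ _
     (mkcfg (if accepting (guessed g w) then goto Emit else inr Unknown) T' [::])).
    rewrite successors_transitions // /transitions enum_rankK v0 eqxx enum_set1 /=.
    by congr [:: (_, _, _)]; apply/ffunP => j; rewrite !ffunE.
  apply: (@computes_ext _ _ _ _ (eq (verdict D g w))).
    move=> o; split=> [<-|[w' /size0nil -> ->//]]; by exists [::].
  rewrite /verdict; case: ifP => acc; last exact: computes_halted.
  have rT : represents T' (stack g w).
    by move=> i; rewrite /T' !ffunE /=; eexists.
  apply: (@computes_le _ _ (3 * (3 * size w + 3) + 1)); first by rewrite addn1.
  apply: (@check_tapes D _ _ (entry g w) _ _ _ rT).
    move=> i i0; have := stack_letters g w i0; rewrite /entry.
    by case: (expected g i) => [e|] //= ->; rewrite size_letters.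
  apply: leq_trans (_ : #|predC1 (ord0 : 'I_4)| <= 3); last by rewrite cardC1 card_ord.
  by apply: subset_leq_card; apply/fintype.subsetP => i; rewrite !inE => /andP [].
rewrite addSn; set c := mkcfg _ _ _.
have succ : successors D c =i
   [seq mkcfg (goto (Guess (guessed g (ch :: w))))
      (guess_tapes g (ch :: w) ([seq Some (inl b) | b <- xs] ++ r)) [::]
      | ch in {: guess}].
  rewrite successors_transitions // /transitions enum_rankK.
  have -> : (scan c ord0 == None) = false by rewrite !ffunE.
  have actE ch : @act guesser (guess_action (guessed g w) ch) c =
     mkcfg (goto (Guess (guessed g (ch :: w))))
      (guess_tapes g (ch :: w) ([seq Some (inl b) | b <- xs] ++ r)) [::].
    congr (_, _, _); apply/ffunP => i; rewrite !ffunE /=.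
    by case: (i =P ord0) => [->|].
  move=> d; apply/mapP/fintype.imageP => [[a]|[ch _ ->]].
    by rewrite mem_enum => /imsetP [ch _ ->] ->; exists ch; rewrite ?inE ?actE.
  exists (guess_action (guessed g w) ch); last by rewrite actE.
  by rewrite mem_enum; apply: imset_f.
have step ch := IH (ch :: w).
apply: (@computes_ext _ _ _ _
  (fun o => exists2 c', c' \in successors D c & reaches D c' o)).
  move=> o; split=> [[c']|[w' sw ->]].
    rewrite succ => /fintype.imageP [ch _ ->] /(step ch).2 [w' sw ->].
    by exists (rcons w' ch); rewrite ?size_rcons ?sw ?cat_rcons.
  case: (lastP w') sw => [//|{}w' ch]; rewrite size_rcons => -[sw].
  exists (mkcfg (goto (Guess (guessed g (ch :: w))))
      (guess_tapes g (ch :: w) ([seq Some (inl b) | b <- xs] ++ r)) [::]).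
    by rewrite succ; apply: fintype.image_f.
  by apply/(step ch).2; exists w' => //; rewrite cat_rcons.
apply: computes_step.
  move=> e; have : mkcfg (goto (Guess (guessed g ((true, true, true) :: w))))
      (guess_tapes g ((true, true, true) :: w) ([seq Some (inl b) | b <- xs] ++ r)) [::]
      \in successors D c by rewrite succ; apply: fintype.image_f.
  by rewrite e.
move=> c'; rewrite succ => /fintype.imageP [ch _ ->]; split=> //.
by have := (step ch).1; rewrite /= [size xs + (size w).+1]addnS -addSn.
Qed.

Lemma guesser_computes D x :
  computes D (size x + (3 * (3 * size x + 3) + 3)) (init guesser x)
    (fun o => exists2 g, g \in starts &
              exists2 w, size w = size x & o = verdict D g w).
Proof.
(* On the empty input the first action writes the scanned blank back, which turns the empty list
   into [[:: None]]. *)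
pose r : seq sym := if x is [::] then [:: None] else [::].
pose C g := mkcfg (goto (Guess g))
  (guess_tapes g [::] ([seq Some (inl b) | b <- x] ++ r)) [::].
have succ : successors D (init guesser x) =i [seq C g | g in starts].
  rewrite -/(mkcfg (goto Start) (init guesser x).1.2 [::]).
  rewrite successors_transitions // /transitions enum_rankK.
  set v := scan _; have actE g : @act guesser (start_action v g) (init guesser x) = C g.
    congr (_, _, _); apply/ffunP => i; rewrite !ffunE /=.
    case: (i =P ord0) => [_|_] //=; rewrite /r.
    by case: (x) => [|? ?] //=; rewrite cats0.
  move=> d; apply/mapP/fintype.imageP => [[a]|[g gs ->]].
    by rewrite mem_enum => /imsetP [g gs ->] ->; exists g; rewrite ?actE.
  exists (start_action v g); last by rewrite actE.
  by rewrite mem_enum; apply: imset_f.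
have hr : head None r = None by rewrite /r; case: (x).
have step g := guess_phase D g [::] x hr.
rewrite !addnS; apply: (@computes_ext _ _ _ _
  (fun o => exists2 c', c' \in successors D (init guesser x) & reaches D c' o)).
  move=> o; split=> [[c']|[g gs [w sw ->]]].
    rewrite succ => /fintype.imageP [g gs ->] /(step g).2 [w' sw ->].
    by exists g => //; exists w'; rewrite ?cats0.
  exists (C g); first by rewrite succ; apply: fintype.image_f.
  by apply/(step g).2; exists w; rewrite ?cats0.
apply: computes_step.
  move=> e; have : C Origin \in successors D (init guesser x).
    by rewrite succ; apply: fintype.image_f; rewrite !inE.
  by rewrite e.
move=> c'; rewrite succ => /fintype.imageP [g gs ->]; split=> //.
by have := (step g).1; rewrite /= addn0 !addnS.
Qed.

Lemma guesser_NPTM : NPTM guesser.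
Proof.
split=> [D x p rp|].
  exact: (bounded_path (guesser_computes D x).1 rp).2.
exists ((10%N)%:P * 'X + (12%N)%:P)%R => D x p rp.
have [+ _] := bounded_path (guesser_computes D x).1 rp.
move/leq_trans; apply; rewrite hornerD hornerCM hornerX hornerC.
change (size x + (3 * (3 * size x + 3) + 3) <= 10 * size x + 12); lia.
Qed.

Lemma out_guesser D x o :
  out guesser D x o <-> exists2 g, g \in starts &
              exists2 w, size w = size x & o = verdict D g w.
Proof. exact: (guesser_computes D x).2. Qed.

(** * Violations *)

(* Blocks are listed least significant bit first, and p, a suffix of the list for
   the next block, grows at its head. *)
Definition node (u p : seq bool) : seq letter :=
  zip u (nseq (size u - size p) None ++ map Some p).

Definition active (D : language) (u p : seq bool) : bool := code (node u p) \in D.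

Fixpoint value (u : seq bool) : nat := if u is b :: u' then b + (value u').*2 else 0.

Definition violation (D : language) (u : seq bool) : Prop :=
  [\/ exists2 p, size p < size u &
        [/\ active D u p, ~~ active D u (false :: p) & ~~ active D u (true :: p)],
      exists2 p, size p = size u &
        active D u p /\ (value u < value p -> ~~ active D p [::]) |
      value u = 0 /\ ~~ active D u [::]].

Definition outcome_bit (b : bool) : outcome := if b then Acc else Rej.

Lemma node_short a u p : size p <= size u -> node (a :: u) p = (a, None) :: node u p.
Proof. by move=> le; rewrite /node /= subSn. Qed.

Lemma node_full a b u p : size p = size u ->
  node (a :: u) (b :: p) = (a, Some b) :: node u p.
Proof. by move=> e; rewrite /node /= subSS e subnn. Qed.

Lemma size_node u p : size p <= size u -> size (node u p) = size u.
Proof. by move=> le; rewrite size_zip size_cat size_nseq size_map subnK // minnn. Qed.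

Lemma value_lt u : value u < 2 ^ size u.
Proof. by elim: u => //= b u IH; rewrite expnS; case: b; lia. Qed.

Lemma value0 u : value u = 0 -> u = nseq (size u) false.
Proof. by elim: u => //= -[] u IH //; rewrite add0n => h; rewrite -IH //; lia. Qed.

Lemma value_nseq n : value (nseq n false) = 0.
Proof. by elim: n => //= n ->. Qed.

Lemma value_inj u v : size u = size v -> value u = value v -> u = v.
Proof.
elim: u v => [|a u IH] [|b v] //= [s] e.
have ab : a = b by case: a b e => [] [] //; lia.
by rewrite ab (IH v) //; move: e; rewrite ab; lia.
Qed.

Lemma value_surj n k : k < 2 ^ n -> exists2 u, size u = n & value u = k.
Proof.
elim: n k => [|n IH] k; first by case: k => // _; exists [::].
rewrite expnS => lt; have [|u su vu] := IH k./2; first by lia.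
by exists (odd k :: u); rewrite /= ?su ?vu ?odd_double_half.
Qed.

Lemma odd_value u : odd (value u) = head false u.
Proof. by case: u => //= b u; rewrite oddD odd_double addbF oddb. Qed.

(** * Nodes spelled out by guess sequences *)

Definition firsts (w : seq guess) : seq bool := [seq ch.1.1 | ch <- w].
Definition seconds (w : seq guess) : seq bool := [seq ch.1.2 | ch <- w].
Definition pairs (u p : seq bool) : seq guess := [seq (x.1, x.2, false) | x <- zip u p].

Lemma firsts_pairs u p : size p = size u -> firsts (pairs u p) = u.
Proof.
by move=> e; rewrite /firsts /pairs -map_comp -[RHS](@unzip1_zip _ _ u p) ?e.
Qed.

Lemma seconds_pairs u p : size p = size u -> seconds (pairs u p) = p.
Proof.
by move=> e; rewrite /seconds /pairs -map_comp -[RHS](@unzip2_zip _ _ u p) ?e.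
Qed.

Lemma size_pairs u p : size p = size u -> size (pairs u p) = size u.
Proof. by move=> e; rewrite size_map size_zip e minnn. Qed.

(** Invariant: until p ends all tapes carry the same node; afterwards tape 1 holds the parent and
    tapes 2 and 3 its children. *)
Lemma letters_interior w :
  match guessed Interior w with
  | Interior => forall i, letters Interior w i = node (firsts w) (seconds w)
  | Settled => exists2 p, size p < size w &
      [/\ letters Interior w 1 = node (firsts w) p,
          letters Interior w 2 = node (firsts w) (false :: p) &
          letters Interior w 3 = node (firsts w) (true :: p)]
  | _ => False
  end.
Proof.
elim: w => [|[[a b] c] w] //=; case: (guessed Interior w) => //=.
  case: c => h /=; last by move=> i; rewrite h node_full ?size_map.
  exists (seconds w); first by rewrite size_map.
  by rewrite !h node_short ?size_map // !node_full ?size_map.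
case=> p lt [-> -> ->]; exists p; first exact: ltnW.
by rewrite !node_short ?size_map // ltnW.
Qed.

Lemma letters_full f s w :
  letters (Full f s) w 1 = node (firsts w) (seconds w) /\
  letters (Full f s) w 2 = node (seconds w) [::].
Proof.
have full : forall w, exists s', guessed (Full f s) w = Full f s'.
  by elim=> [|[[a b] c] w' [s' /= ->]] /=; eexists.
elim: w => //= -[[a b] c] w [h1 h2].
have [s' ->] := full w; rewrite h1 h2.
by rewrite node_full ?size_map // node_short.
Qed.

Lemma letters_origin w :
  guessed Origin w = Origin /\ letters Origin w 1 = node (nseq (size w) false) [::].
Proof. by elim: w => //= -[[a b] c] w [-> ->]; rewrite node_short. Qed.

Lemma guessed_full f w :
  guessed (Full f None) w = Full f
    (if value (firsts w) < value (seconds w) then Some true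
     else if value (seconds w) < value (firsts w) then Some false else None).
Proof.
elim: w => //= -[[a b] c] w -> /=; congr Full; rewrite /compare_step.
by case: a b => [] []; (do ?[case: ltnP => ?]) => //; exfalso; lia.
Qed.

Lemma label_stack g w : g != Origin ->
  label (stack g w ord0) = outcome_bit (head false (firsts w)).
Proof.
move=> gO; case: w => [|[[a b] c] w] //=; rewrite /label /guess_symbol /= /guess_bit.
have : guessed g w != Origin.
  by elim: w => //= -[[a' b'] c'] w; case: (guessed g w) => //=; case: c'.
by case: (guessed g w) => //=; case: a.
Qed.

Lemma label_origin w : label (stack Origin w ord0) = Rej.
Proof.
by case: w => [|[[a b] c] w] //=; rewrite /label /guess_symbol (letters_origin w).1.
Qed.

Lemma checks_split D g w :
  [forall i : 'I_4, (i != ord0) ==> check D (entry g w i)] =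
  [&& check D (entry g w 1), check D (entry g w 2) & check D (entry g w 3)].
Proof.
apply/forallP/and3P => [h|[h1 h2 h3]].
  by split; [have := h (@Ordinal 4 1 isT)|have := h (@Ordinal 4 2 isT)|
             have := h (@Ordinal 4 3 isT)].
by case=> [[|[|[|[|]]]]].
Qed.

(** Each start state covers one kind of violation; the two [Full] states share the second kind
    according to whether u < p, since only then is the root of block p queried. Conversely, a
    violation dictates the guesses that find it. *)
Lemma out_violation D x b :
  out guesser D x (outcome_bit b) <->
  exists2 u, violation D u & size u = size x /\ head false u = b.
Proof.
rewrite out_guesser; split.
  case=> g; rewrite !inE => gs [w sw]; rewrite /verdict checks_split.
  case: ifP => [|_]; last by case: b.
  case/andP; case/or4P: gs => /eqP -> /=.
  - rewrite label_stack //.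
    have := letters_interior w; case: (guessed Interior w) => // -[p lp] [].
    rewrite /entry /= => -> -> -> _ /and3P [/eqP h1 /eqP h2 /eqP h3] eb.
    exists (firsts w); last by split; [rewrite size_map|case: b (head _ _) eb => [] []].
    by apply: Or31; exists p; rewrite ?size_map // /active h1 h2 h3.
  - rewrite label_stack // guessed_full /=.
    have [-> ->] := letters_full true None w.
    case: ltnP => [lt|le]; last by case: ltnP.
    move=> _ /and3P [/eqP h1 /eqP h2 _] eb.
    exists (firsts w); last by split; [rewrite size_map|case: b (head _ _) eb => [] []].
    apply: Or32; exists (seconds w); first by rewrite !size_map.
    by rewrite /active h1 h2.
  - rewrite label_stack // guessed_full /=.
    have [-> _] := letters_full false None w.
    case: ltnP => [//|le].
    move=> _ /andP [/eqP h1 _] eb.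
    exists (firsts w); last by split; [rewrite size_map|case: b (head _ _) eb => [] []].
    apply: Or32; exists (seconds w); first by rewrite !size_map.
    by rewrite /active h1; split=> //; rewrite ltnNge le.
  - rewrite label_origin; have [_ ->] := letters_origin w.
    move=> _ /andP [/eqP h1 _] eb.
    exists (nseq (size w) false); last first.
      by rewrite size_nseq sw; split=> //; case: b eb => //; case: (size x).
    by apply: Or33; rewrite value_nseq /active h1.
case=> u viol [su ub]; case: viol.
- case=> p lp [h1 h2 h3]; exists Interior; first by rewrite !inE.
  have [w [w1 w2 w3]] : exists w, [/\ guessed Interior w = Settled, firsts w = u &
     [/\ letters Interior w 1 = node u p, letters Interior w 2 = node u (false :: p)
       & letters Interior w 3 = node u (true :: p)]].
    (* The flag is raised at the position just past p; on the lower bits of u the state is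
       [Settled]. *)
    elim: u lp {su ub h1 h2 h3} => //= a u IH; rewrite ltnS leq_eqVlt.
    case/orP=> [/eqP e|lt].
      exists ((a, false, true) :: pairs u p).
      have := letters_interior (pairs u p); rewrite firsts_pairs // seconds_pairs //.
      have /= -> : guessed Interior (pairs u p) = Interior.
        by rewrite /pairs; elim: (zip u p) => //= y s ->.
      move=> h; rewrite !h firsts_pairs // node_short ?e // !node_full //.
    have [w [w1 w2 [w3 w4 w5]]] := IH lt.
    exists ((a, false, false) :: w); rewrite /= w1 w2 w3 w4 w5.
    by rewrite !node_short // ltnW.
  exists w; first by rewrite -su -w2 size_map.
  rewrite /verdict checks_split w1 label_stack // w2 ub /entry /=.
  by case: w3 => -> -> ->; rewrite -!/(active _ _ _) h1 (negbTE h2) (negbTE h3).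
- case=> p sp [h1 h2].
  have [f|f] := ltnP (value u) (value p).
    exists (Full true None); first by rewrite !inE.
    exists (pairs u p); first by rewrite size_pairs.
    rewrite /verdict checks_split guessed_full label_stack // /entry /=.
    have [-> ->] := letters_full true None (pairs u p).
    rewrite firsts_pairs // seconds_pairs // f ub -!/(active _ _ _) h1.
    by rewrite (negbTE (h2 f)).
  exists (Full false None); first by rewrite !inE.
  exists (pairs u p); first by rewrite size_pairs.
  rewrite /verdict checks_split guessed_full label_stack // /entry /=.
  have [-> _] := letters_full false None (pairs u p).
  rewrite firsts_pairs // seconds_pairs // ltnNge f /= ub -!/(active _ _ _) h1 /=.
  by case: (value p < value u).
- case=> /value0 u0 h; exists Origin; first by rewrite !inE.
  exists (pairs u u); first by rewrite size_pairs.
  rewrite /verdict checks_split label_origin /entry /=.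
  have [-> ->] := letters_origin (pairs u u); rewrite size_pairs // -u0.
  rewrite -/(active _ _ _) (negbTE h) /=.
  by move: ub; rewrite u0; case: (size u) => [|k] <-.
Qed.

(** If the root of block 0 is active, two extremal choices replace the walk: u is the largest block
    with active root and p a longest active string in it. If |p| < n, both children are inactive;
    otherwise an active root of a block p above u would contradict the choice of u. *)
Lemma violation_exists D n : exists2 u, violation D u & size u = n.
Proof.
have [h|h] := boolP (active D (nseq n false) [::]); last first.
  exists (nseq n false); last by rewrite size_nseq.
  by apply: Or33; rewrite value_nseq.
have [u [su ru mu]] : exists u, [/\ size u = n, active D u [::] &
    forall v, size v = n -> active D v [::] -> value v <= value u].
  have ex : exists k, `[< exists2 u, size u = n & active D u [::] /\ value u = k >].
    by exists 0; apply/asboolP; exists (nseq n false); rewrite ?size_nseq ?value_nseq.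
  have ub k : `[< exists2 u, size u = n & active D u [::] /\ value u = k >] -> k <= 2 ^ n.
    by case/asboolP=> u <- [_ <-]; apply/ltnW/value_lt.
  case: (ex_maxnP ex ub) => k /asboolP [u su [au <-]] mx.
  exists u; split=> // v sv av; apply: mx; apply/asboolP; by exists v.
exists u => //.
have [p [sp ap mp]] : exists p, [/\ size p <= n, active D u p &
    forall q, size q <= n -> active D u q -> size q <= size p].
  have ex : exists k, `[< exists2 p, size p <= n & active D u p /\ size p = k >].
    by exists 0; apply/asboolP; exists [::].
  have ub k : `[< exists2 p, size p <= n & active D u p /\ size p = k >] -> k <= n.
    by case/asboolP=> p sp [_ <-].
  case: (ex_maxnP ex ub) => k /asboolP [p sp [ap <-]] mx.
  exists p; split=> // q sq aq; apply: mx; apply/asboolP; by exists q.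
have [lt|ge] := ltnP (size p) n.
  apply: Or31; exists p; first by rewrite su.
  by split=> //; apply/negP => /(mp (_ :: p) lt) /=; rewrite ltnn.
apply: Or32; exists p; first by apply/eqP; rewrite su eqn_leq sp.
have sp' : size p = n by apply/eqP; rewrite eqn_leq sp.
by split=> // vl; apply/negP => ap'; have := mu p sp' ap'; rewrite leqNgt vl.
Qed.

Lemma guesser_overproductive : robustly_overproductive guesser.
Proof.
move=> D x e; have [u vu su] := violation_exists D (size x).
have : out guesser D x (outcome_bit (head false u)).
  by apply/out_violation; exists u.
by rewrite e; case: (head _ _).
Qed.

(** * The adversary *)

Lemma bits_inj : injective bits.
Proof. by case=> a [b|] [a' [b'|]] //= [-> //] ->. Qed.

Lemma code_inj : injective code.
Proof.
elim=> [|a z IH] [|a' z'] //; rewrite /code /= => -[e1 e2 e3 /IH ->].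
by congr (_ :: _); apply: bits_inj; rewrite /bits e1 e2 e3.
Qed.

Lemma size_code z : size (code z) = 3 * size z.
Proof. by elim: z => //= a z; rewrite /code /= => ->; lia. Qed.

Lemma unzip1_node u p : size p <= size u -> unzip1 (node u p) = u.
Proof. by move=> le; rewrite unzip1_zip // size_cat size_nseq size_map subnK. Qed.

Lemma node_inj u p v q : size u = size v -> size p <= size u -> size q <= size v ->
  node u p = node v q -> u = v /\ p = q.
Proof.
move=> s sp sq e.
have uv : u = v by rewrite -(unzip1_node sp) e unzip1_node.
split=> //; have : unzip2 (node u p) = unzip2 (node v q) by rewrite e.
rewrite /node !unzip2_zip ?size_cat ?size_nseq ?size_map ?subnK // s.
elim: (size v - size p) (size v - size q) => [|i IH] [|j] /=.
- by move/inj_map; apply; move=> ? ? [].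
- by case: p {sp e}.
- by clear IH; case: q {sq e}.
- by case=> /IH.
Qed.

Definition agree (P : seq bool -> Prop) (D D' : language) : Prop :=
  forall s, P s -> (s \in D) = (s \in D').

Lemma agreeC P D D' : agree P D D' -> agree P D' D.
Proof. by move=> h s /h. Qed.

Lemma agree_trans P D D' D'' : agree P D D' -> agree P D' D'' -> agree P D D''.
Proof. by move=> h h' s Ps; rewrite h // h'. Qed.

Lemma agree_sub (P P' : seq bool -> Prop) D D' :
  (forall s, P s -> P' s) -> agree P' D D' -> agree P D D'.
Proof. by move=> h h' s /h /h'. Qed.

(** All lists of [n] letters count, not only nodes, so levels are told apart by string length
    alone. *)
Definition node_string (n : nat) (s : seq bool) : Prop :=
  exists2 z, size z = n & s = code z.

Lemma active_agree D D' n u p : agree (node_string n) D D' ->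
  size u = n -> size p <= n -> active D u p = active D' u p.
Proof.
by move=> h su sp; apply: h; exists (node u p) => //; rewrite size_node su.
Qed.

Lemma violation_agree D D' n u : agree (node_string n) D D' ->
  size u = n -> violation D u -> violation D' u.
Proof.
move=> h su; have a := active_agree h; case.
- case=> p sp [h1 h2 h3]; apply: Or31; exists p => //.
  by rewrite -!a //= -?su // ltnW.
- case=> p sp [h1 h2]; apply: Or32; exists p => //.
  by rewrite -!a // ?sp -?su.
- by case=> h1 h2; apply: Or33; rewrite -a.
Qed.

(** * Positions and moves of the adversary *)

Section Adversary.
Variables (n : nat) (B : language).

(* The strings decided once the blocks with numbers in [T] are. *)
Definition fixed (T : seq nat) (s : seq bool) : Prop :=
  forall z, size z = n -> s = code z -> value (unzip1 z) \in T.

Lemma fixed_node T u p : size u = n -> size p <= n ->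
  fixed T (code (node u p)) -> value u \in T.
Proof.
move=> su sp /(_ (node u p)); rewrite size_node su // unzip1_node ?su //.
by move/(_ erefl erefl).
Qed.

Lemma fixed_sub T T' s : {subset T <= T'} -> fixed T s -> fixed T' s.
Proof. by move=> h f z sz e; apply: h; apply: f. Qed.

(** [T] lists the revealed blocks. Outside them only the root of u is active, so u is the only block
    that can carry a violation; the active root of block 0 excludes the third kind. *)
Record position (T : seq nat) (u : seq bool) (D : language) : Prop := Position {
  pos_size : size u = n;
  pos_fresh : value u \notin T;
  pos_root : active D u [::];
  pos_origin : active D (nseq n false) [::];
  pos_blank : forall v p, size v = n -> size p <= n -> value v \notin T ->
    active D v p -> v = u /\ p = [::];
  pos_settled : forall v, size v = n -> value v \in T -> ~ violation D v;
  pos_agree : agree (fun s => ~ node_string n s) D B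
}.

Lemma violation_inactive T u D v : position T u D -> size v = n ->
  value v \notin T -> violation D v -> v = u.
Proof.
move=> pos sv vT; case.
- case=> p sp [h1 _ _]; apply: (pos_blank pos sv _ vT h1).1.
  by rewrite -sv ltnW.
- by case=> p sp [h1 _]; apply: (pos_blank pos sv _ vT h1).1; rewrite sp sv.
- by case=> /value0 -> ; rewrite sv (pos_origin pos).
Qed.

Lemma position_violation T u D v : position T u D -> size v = n ->
  violation D v -> v = u.
Proof.
move=> pos sv viol; have [vT|vT] := boolP (value v \in T).
  by case: (pos_settled pos sv vT viol).
exact: violation_inactive pos sv vT viol.
Qed.

(** An unrevealed block other than u carries no violation, so it can be revealed as it stands. *)
Lemma position_fix T u D w : position T u D -> w != value u ->
  position (w :: T) u D.
Proof.
move=> pos wu; split; try by case: pos.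
- by rewrite inE negb_or eq_sym wu (pos_fresh pos).
- move=> v p sv sp; rewrite inE negb_or => /andP [_ vT]; exact: (pos_blank pos).
- move=> v sv; rewrite inE; have [vT _|vT] := boolP (value v \in T).
    exact: (pos_settled pos).
  rewrite orbF => /eqP vw /(violation_inactive pos sv vT) vu.
  by rewrite -vw vu eqxx in wu.
Qed.

(** For |v| = n the suffixes [drop k v] form the path in block u from its root, at [k = n], to the
    leaf v, at [k = 0]; the last clause activates the root of block v. *)
Definition extend (D : language) (u v : seq bool) : language :=
  [set s | [\/ D s, exists2 k, k <= n & s = code (node u (drop k v)) |
               s = code (node v [::])]]%classic.

Lemma extendP D u v s : reflect
  [\/ s \in D, exists2 k, k <= n & s = code (node u (drop k v)) |
      s = code (node v [::])] (s \in extend D u v).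
Proof. by apply: (iffP idP); rewrite !in_setE. Qed.

(** The path repairs block u: each inner node has its successor on the path active, and the leaf v
    names a larger block with active root. Only the blocks u and v change, and neither is in [T]. *)
Lemma position_extend T u D v : position T u D -> size v = n ->
  value v \notin T -> value u < value v ->
  position (value u :: T) v (extend D u v) /\ agree (fixed T) (extend D u v) D.
Proof.
move=> pos sv vT uv; have su := pos_size pos.
have sub w p : active D w p -> active (extend D u v) w p.
  by move=> h; apply/extendP; apply: Or31.
have sd k : size (drop k v) <= n by rewrite size_drop sv leq_subr.
have inv w p : size w = n -> size p <= n -> active (extend D u v) w p ->
    [\/ active D w p, w = u /\ (exists2 k, k <= n & p = drop k v) |
        w = v /\ p = [::]].
  move=> sw sp /extendP [h|[k kn]|] //; first exact: Or31.
  - move/code_inj/node_inj; rewrite sw su => -[] // -> ->.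
    by apply: Or32; split=> //; exists k.
  - by move/code_inj/node_inj; rewrite sw sv => -[] // -> ->; apply: Or33.
have uNv : u <> v by move=> e; rewrite e ltnn in uv.
have other w p : size w = n -> size p <= n -> w <> u -> w <> v ->
    active (extend D u v) w p = active D w p.
  move=> sw sp wu wv; apply/idP/idP; last exact: sub.
  by case/inv => // -[].
have drop_active k : k <= n -> active (extend D u v) u (drop k v).
  by move=> kn; apply/extendP; apply: Or32; exists k.
have v_active : active (extend D u v) v [::] by apply/extendP; apply: Or33.
have u_inv p : size p <= n -> active (extend D u v) u p ->
    exists2 k, k <= n & p = drop k v.
  move=> sp /inv [] //.
  - move=> /(pos_blank pos su sp (pos_fresh pos)) [_ ->].
    by exists n; rewrite // -sv drop_size.
  - by case.
  - by case.
split; first split=> //.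
- rewrite inE negb_or vT andbT; by rewrite neq_ltn uv orbT.
- exact/sub/(pos_origin pos).
- move=> w p sw sp; rewrite inE negb_or => /andP [wu wT] /inv [] //.
    move=> /(pos_blank pos sw sp wT) [e _]; by rewrite e eqxx in wu.
  by case=> e; rewrite e eqxx in wu.
- move=> w sw; rewrite inE; case/orP => [/eqP /value_inj|wT].
    rewrite sw su => /(_ erefl) -> {w sw}; case.
    + case=> p; rewrite su => sp [/(u_inv _ (ltnW sp)) [k kn ep] h2 h3].
      have k0 : 0 < k.
        by rewrite lt0n; apply/eqP => k0; rewrite ep k0 drop0 sv ltnn in sp.
      have : active (extend D u v) u (drop k.-1 v) by apply: drop_active; lia.
      (* [drop k.-1 v] is the child of p on the path, so the two children are not both inactive. *)
      rewrite (drop_nth false) ?sv; last by lia.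
      rewrite prednK // -ep; move: h2 h3; case: (nth _ _ _).
        by move=> _ /negbTE ->.
      by move/negbTE => ->.
    + case=> p; rewrite su => sp [/u_inv []]; first by rewrite sp.
      move=> k kn ep.
      have : size p = n - k by rewrite ep size_drop sv.
      rewrite sp => k0; have {}k0 : k = 0 by lia.
      by rewrite ep k0 drop0 => /(_ uv); rewrite v_active.
    + by case=> _; rewrite (sub _ _ (pos_root pos)).
  (* A violation at an older block [w] would be one for [D] already: activity within [w] is
     unchanged, and a larger oracle has no new inactive roots. *)
  move=> viol; apply: (pos_settled pos sw wT).
  have wu : w <> u by move=> e; have := pos_fresh pos; rewrite -e wT.
  have wv : w <> v by move=> e; rewrite -e wT in vT.
  case: viol.
  + case=> p sp [h1 h2 h3]; apply: Or31; exists p => //.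
    by rewrite sw in sp; rewrite -!other // ltnW.
  + case=> p sp [h1 h2]; apply: Or32; exists p => //.
    split; first by rewrite -other ?sp ?sw.
    move=> /h2; apply: contra; exact: sub.
  + by case=> h1 h2; apply: Or33; rewrite -other.
- move=> s ns; rewrite -(pos_agree pos) //; apply/extendP/idP; last exact: Or31.
  case=> // [[k kn]|] e; case: ns.
    by exists (node u (drop k v)); rewrite // size_node su.
  by exists (node v [::]); rewrite // size_node.
- move=> s fs; apply/extendP/idP; last exact: Or31.
  case=> // [[k kn]|] e; rewrite e in fs.
    by have := fixed_node su (sd k) fs; rewrite (negbTE (pos_fresh pos)).
  by have := @fixed_node T v [::] sv isT fs; rewrite (negbTE vT).
Qed.

(** Pigeonhole: the first |T| + 1 numbers above [k] of the required parity cannot all lie in [T]. *)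
Lemma fresh_number (T : seq nat) (k : nat) (b : bool) :
  exists m, [/\ k < m, m <= k + (size T).*2 + 2, m \notin T & odd m = b].
Proof.
pose f i := k.+1 + (odd k.+1 (+) b) + i.*2.
have [h|/allPn [m /mapP [i]]] := boolP (all (mem T) (map f (iota 0 (size T).+1))).
  have un : uniq (map f (iota 0 (size T).+1)).
    by rewrite map_inj_uniq ?iota_uniq // /f => i j; lia.
  by have := uniq_leq_size un (fun x => allP h x); rewrite size_map size_iota ltnn.
rewrite mem_iota add0n ltnS => /= le -> mT; exists (f i); split=> //.
- by rewrite /f; lia.
- by rewrite /f; case: (_ (+) _); lia.
- by rewrite /f !oddD odd_double addbF; case: (odd k.+1); case: (b).
Qed.

Variables (R : nat).

(** [R] bounds the number of blocks ever revealed, and [j] moves are still allowed. By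
    [fresh_number] a move raises the current block number by at most 2R + 2, so the second
    inequality keeps it below 2^n. *)
Definition budget (T : seq nat) (u : seq bool) (j : nat) : Prop :=
  size T + j <= R /\ value u + j * (2 * R + 2) < 2 ^ n.

Lemma budget_extend T u v j : budget T u j.+1 ->
  value v <= value u + (size T).*2 + 2 -> budget (value u :: T) v j.
Proof. by case=> h1 h2 h3; split=> /=; [lia|rewrite mulSn in h2; lia]. Qed.

Lemma budget_le T u j j' : j <= j' -> budget T u j' -> budget T u j.
Proof.
move=> le [h1 h2]; split; first by apply: leq_trans h1; rewrite leq_add2l.
by apply: leq_ltn_trans h2; rewrite leq_add2l leq_mul2r le orbT.
Qed.

Lemma budget_cons T u m j : budget T u j.+1 -> budget (m :: T) u j.
Proof.
move=> bud; split; first by case: bud; rewrite /= addSnnS.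
exact: (budget_le (leqnSn j) bud).2.
Qed.

Lemma extend_bit T u D j b : position T u D -> budget T u j.+1 ->
  exists v D', [/\ position (value u :: T) v D', head false v = b,
    agree (fixed T) D' D & budget (value u :: T) v j].
Proof.
move=> pos bud; have [m [um mle mT mb]] := fresh_number T (value u) b.
have [|v sv vm] := @value_surj n m.
  by case: bud => h1 h2; rewrite mulSn in h2; lia.
have [||p a] := position_extend pos sv; rewrite ?vm //.
exists v, (extend D u v); split=> //; first by rewrite -odd_value vm.
by apply: budget_extend; rewrite ?vm.
Qed.

(** Each string of [Q] costs at most one move: off level [n] nothing is done, in block u the
    violation moves on, and any other block is revealed as it stands. *)
Lemma fix_strings T u D j Q : position T u D -> budget T u (size Q + j) ->
  exists T' v D', [/\ position T' v D', {subset T <= T'},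
    (forall q, q \in Q -> fixed T' q), agree (fixed T) D' D & budget T' v j].
Proof.
elim: Q T u D => [|q Q IH] T u D pos bud; first by exists T, u, D; split.
rewrite addSn in bud.
have [T1 [u1 [D1 [pos1 sub1 fix1 agr1 bud1]]]] : exists T' v D',
   [/\ position T' v D', {subset T <= T'}, fixed T' q, agree (fixed T) D' D &
       budget T' v (size Q + j)].
  have bud' : budget T u (size Q + j).
    exact: budget_le bud.
  have [[z sz qz]|nq] := pselect (node_string n q); last first.
    by exists T, u, D; split=> // z sz e; case: nq; exists z.
  have fq T' : value (unzip1 z) \in T' -> fixed T' q.
    by move=> h z' sz'; rewrite qz => /code_inj <-.
  have [e|e] := eqVneq (value (unzip1 z)) (value u).
    have [v [D' [p _ a b]]] := extend_bit true pos bud.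
    exists (value u :: T), v, D'; split=> //.
      by move=> x xT; rewrite inE xT orbT.
    by apply: fq; rewrite inE e eqxx.
  exists (value (unzip1 z) :: T), u, D; split=> //.
  - exact: position_fix.
  - by move=> x xT; rewrite inE xT orbT.
  - by apply: fq; rewrite inE eqxx.
  - exact: budget_cons.
have [T2 [u2 [D2 [pos2 sub2 fix2 agr2 bud2]]]] := IH _ _ _ pos1 bud1.
exists T2, u2, D2; split=> //.
- by move=> x /sub1 /sub2.
- move=> q'; rewrite inE => /orP [/eqP ->|/fix2 //]; exact: fixed_sub fix1.
- apply: agree_trans agr1; apply: agree_sub agr2 => s; exact: fixed_sub.
Qed.

(** * Functions of the oracle with short certificates *)

Section Decision.
Variables (F : language -> bool -> Prop) (K : nat).
Hypothesis F_total : forall D, F D true \/ F D false.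
Hypothesis F_disjoint : forall D, F D true -> F D false -> False.
Definition certificate b (D : language) (Q : seq (seq bool)) : Prop :=
  size Q <= K /\ forall D', agree (fun s => s \in Q) D' D -> F D' b.
Hypothesis F_certificate : forall D b, F D b -> exists Q, certificate b D Q.

(** Without a conflict, the oracle that follows [D2] on [Q2] and [D1] elsewhere would satisfy both
    certificates and get both answers. *)
Lemma certificates_conflict (P : seq bool -> Prop) D1 D2 Q1 Q2 :
  certificate true D1 Q1 -> certificate false D2 Q2 -> agree P D1 D2 ->
  exists2 q, q \in Q2 & q \in Q1 /\ ~ P q.
Proof.
move=> [_ c1] [_ c2] agr; apply: contrapT => h.
pose D : language := [set s | if s \in Q2 then s \in D2 else s \in D1]%classic.
have DE s : (s \in D) = if s \in Q2 then s \in D2 else s \in D1.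
  by apply/idP/idP; rewrite in_setE.
apply: (@F_disjoint D).
  apply: c1 => s s1; rewrite DE; case: ifP => // s2.
  by rewrite agr //; apply: contrapT => nP; apply: h; exists s.
by apply: c2 => s s2; rewrite DE s2.
Qed.

(** The assumption to be refuted: [F] is right on every oracle that differs from [B] on level [n]
    only and whose violations there carry the same bit. *)
Hypothesis F_decides : forall D b, agree (fun s => ~ node_string n s) D B ->
  (forall u, size u = n -> violation D u -> head false u = b) -> F D b.

Lemma position_decided T u D : position T u D -> F D (head false u).
Proof.
move=> pos; apply: F_decides; first exact: pos_agree pos.
by move=> v sv /(position_violation pos sv) ->.
Qed.

Definition unfixed T (q : seq bool) : bool := ~~ `[< fixed T q >].

(* Every certificate for [false] meets every certificate for [true] outside the
   strings fixed so far, so fixing the latter shortens all of the former. *)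
Lemma no_position t T u D : position T u D -> budget T u (t * K.+1).+1 ->
  (forall D' Q, agree (fixed T) D' D -> certificate false D' Q ->
     count (unfixed T) Q <= t) -> False.
Proof.
elim: t T u D => [|t IH] T u D pos bud small.
(* The violation moves to an odd block, where [F] answers [true]; [Q1] will certify this. *)
all: have [u1 [D1 [pos1 b1 agr1 bud1]]] := extend_bit true pos bud.
all: have [Q1 cert1] : exists Q, certificate true D1 Q
  by apply: F_certificate; rewrite -b1; apply: position_decided pos1.
all: have conflict D' Q : agree (fixed T) D' D -> certificate false D' Q ->
    exists2 q, q \in Q & q \in Q1 /\ ~ fixed T q
  by move=> a c; apply: (certificates_conflict cert1 c);
     apply: agree_trans agr1 (agreeC a).
(* For [t = 0] no certificate for [false] leaves the fixed strings, yet one obtained from an even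
   block must meet [Q1] outside them. *)
- have [u2 [D2 [pos2 b2 agr2 _]]] := extend_bit false pos bud.
  have [Q2 cert2] : exists Q, certificate false D2 Q.
    by apply: F_certificate; rewrite -b2; apply: position_decided pos2.
  have [q q2 [_ nq]] := conflict _ _ agr2 cert2.
  have := small _ _ agr2 cert2; rewrite leqn0 => /eqP h.
  have : has (unfixed T) Q2 by apply/hasP; exists q => //; apply/asboolPn.
  by rewrite has_count h.
- have sQ1 := cert1.1.
  (* The move to [u1] has cost one unit and revealing [Q1] takes at most [K], so [(t * K.+1).+1]
     units remain. *)
  have bud1' : budget (value u :: T) u1 (size Q1 + (t * K.+1).+1).
    by apply: budget_le bud1; rewrite mulSn addnS addSn ltnS leq_add2r.
  have [T2 [u2 [D2 [pos2 sub2 fix2 agr2 bud2]]]] := fix_strings pos1 bud1'.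
  have subT : {subset T <= T2} by move=> x xT; apply: sub2; rewrite inE xT orbT.
  apply: (IH _ _ _ pos2 bud2) => D' Q agr cert.
  have agr' : agree (fixed T) D' D.
    apply: agree_trans (agree_sub (P' := fixed T2) _ agr) _.
      by move=> s; apply: fixed_sub.
    apply: agree_trans (agree_sub _ agr2) agr1 => s; apply: fixed_sub => x xT.
    by rewrite inE xT orbT.
  have [q qQ [q1 nq]] := conflict _ _ agr' cert.
  rewrite -ltnS; apply: leq_trans (small _ _ agr' cert).
  have le : {subset unfixed T2 <= unfixed T}.
    move=> s; rewrite /unfixed !unfold_in; apply: contra => /asboolP f.
    by apply/asboolP; apply: fixed_sub f.
  (* The conflicting string [q] is unfixed for [T] but fixed for [T2], so the count drops by at
     least one. *)
  have : has (predI (unfixed T) (predC (unfixed T2))) Q.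
    apply/hasP; exists q => //=; apply/andP; split; first exact/asboolPn.
    by rewrite /unfixed negbK; apply/asboolP; apply: fix2.
  rewrite has_count => pos_count.
  have := count_predUI (unfixed T2) (predI (unfixed T) (predC (unfixed T2))) Q.
  have -> : count (predI (unfixed T2) (predI (unfixed T) (predC (unfixed T2)))) Q = 0.
    rewrite (@eq_count _ _ pred0) ?count_pred0 // => s /=.
    by case: (unfixed T2 s); rewrite ?andbF.
  rewrite addn0 => e; apply: leq_trans (_ : count (predU (unfixed T2)
     (predI (unfixed T) (predC (unfixed T2)))) Q <= _).
    by rewrite e -addn1 leq_add2l.
  by apply: sub_count => s /orP [/le //|/andP []].
Qed.

End Decision.
End Adversary.

Lemma poly_lt_exp (P : {poly nat}) (L : nat) : exists2 n, L <= n & P.[n]%R < 2 ^ n.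
Proof.
pose c := (\sum_(i < size P) P`_i)%R; pose d := size P.
have bound n : 0 < n -> P.[n]%R <= c * n ^ d.
  move=> n0; rewrite horner_coef big_distrl /=; apply: leq_sum => i _.
  rewrite -[(_ ^+ _)%R]/(n ^ i)%N leq_mul2l leq_pexp2l ?orbT //; exact: ltnW.
(* With n = 2^(2m), c n^d is below 2^(c + 2md), and c + 2md <= m^2 < 2^(2m). *)
pose m := c + 2 * d + L + 1; exists (2 ^ (2 * m)).
  by apply: ltnW; apply: leq_ltn_trans (ltn_expl _ _) => //; rewrite /m; lia.
apply: leq_ltn_trans (bound _ _) _; first by rewrite expn_gt0.
rewrite -expnM; apply: leq_trans (_ : 2 ^ c * 2 ^ (2 * m * d) <= _).
  by rewrite ltn_pmul2r ?expn_gt0 // ltn_expl.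
rewrite -expnD leq_exp2l //.
have : m < 2 ^ m by apply: ltn_expl.
by rewrite mul2n -addnn expnD; nia.
Qed.

(** * Diagonalization *)

(** A step depends on the oracle only through the word on the query tape, so it suffices to list
    these words along the path. *)
Lemma path_certificate N D (c : config N) p : path (step D) c p ->
  exists2 Q, size Q = size p &
    forall D', agree (fun s => s \in Q) D' D -> path (step D') c p.
Proof.
elim: p c => [|c' p IH] c /=; first by exists [::].
case/andP=> s /IH [Q sQ h]; exists (query c :: Q); first by rewrite /= sQ.
move=> D' agr; rewrite h ?andbT; last first.
  by move=> q qQ; apply: agr; rewrite inE qQ orbT.
move: s; rewrite /step /successors; case: (control c) => // q.
by rewrite agr // inE eqxx.
Qed.

Lemma out_certificate N D x o k : 
  (forall p, run (N := N) D x p -> size p <= k) -> out N D x o ->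
  exists2 Q, size Q <= k &
    forall D', agree (fun s => s \in Q) D' D -> out N D' x o.
Proof.
move=> bnd [p rp fp]; have [Q sQ h] := path_certificate rp.
by exists Q; [rewrite sQ; apply: bnd|move=> D' /h; exists p].
Qed.

(** The polynomial bound yields a longest run; it cannot be prolonged, so it ends with an
    outcome. *)
Lemma out_nonempty N D x : NPTM N -> exists o, out N D x o.
Proof.
case=> halts [P bnd].
have ex : exists k, `[< exists2 p, run (N := N) D x p & size p = k >].
  by exists 0; apply/asboolP; exists [::].
have ub k : `[< exists2 p, run (N := N) D x p & size p = k >] -> k <= (P.[size x])%R.
  by case/asboolP=> p /bnd + <-.
case: (ex_maxnP ex ub) => k /asboolP [p rp sp] mx.
case e: (successors D (final x p)) => [|c s].
  by have [o h] := halts _ _ _ rp e; exists o; exists p.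
suff : k.+1 <= k by rewrite ltnn.
apply: mx; apply/asboolP; exists (rcons p c); last by rewrite size_rcons sp.
rewrite /run rcons_path; apply/andP; split=> //.
by rewrite /step -/(final x p) e inE eqxx.
Qed.

Lemma out_total N D x : NPTM N -> robustly_overproductive N ->
  out N D x Acc \/ out N D x Rej.
Proof.
move=> poly over; apply: contrapT => /not_orP [nA nR].
apply: (over D x); apply/seteqP; split=> [[]|_ ->] //=.
by have [[]] := out_nonempty D x poly.
Qed.

Definition unambiguous (D : language) (n : nat) : Prop :=
  exists b, forall u, size u = n -> violation D u -> head false u = b.

Lemma unambiguous_agree D D' n : agree (node_string n) D D' ->
  unambiguous D n -> unambiguous D' n.
Proof.
move=> agr [b h]; exists b => u su viol; apply: h => //.
exact: violation_agree (agreeC agr) su viol.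
Qed.

Lemma unambiguous_underproductive D :
  (forall n, unambiguous D n) -> underproductive guesser D.
Proof.
move=> un x h; have [b hb] := un (size x).
have /out_violation [u vu [su hu]] : out guesser D x (outcome_bit true).
  by apply: h; left.
have /out_violation [v vv [sv hv]] : out guesser D x (outcome_bit false).
  by apply: h; right.
by have := hb u su vu; rewrite hu -(hb v sv vv) hv.
Qed.

Definition clear_level (n : nat) (B : language) : language :=
  [set s | s = code (node (nseq n false) [::]) \/ ~ node_string n s /\ B s]%classic.

Lemma clear_position n B :
  position n B [::] (nseq n false) (clear_level n B).
Proof.
have root : active (clear_level n B) (nseq n false) [::].
  by rewrite /active in_setE; left.
split=> //; first by rewrite size_nseq.
- move=> v p sv sp _; rewrite /active in_setE => -[|[nn _]]; last first.
    by case: nn; exists (node v p); rewrite // size_node sv.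
  by move/code_inj/node_inj; rewrite size_nseq sv => -[].
- move=> s ns; apply/idP/idP; rewrite !in_setE; last by right.
  case=> [e|[]//]; case: ns; exists (node (nseq n false) [::]) => //.
  by rewrite size_node ?size_nseq.
Qed.

Lemma decision_errs (F : language -> bool -> Prop) K n B :
  (forall D, F D true \/ F D false) -> (forall D, F D true -> F D false -> False) ->
  (forall D b, F D b -> exists Q, certificate F K b D Q) ->
  (K * K.+1).+1 * (2 * (K * K.+1).+1 + 2) < 2 ^ n ->
  exists D b, [/\ agree (fun s => ~ node_string n s) D B,
    (forall u, size u = n -> violation D u -> head false u = b) & F D (~~ b)].
Proof.
move=> tot dis cert big; apply: contrapT => h.
(* Certificates have at most [K] strings, hence [t = K]; the game starts with no block revealed and
   the violation at block 0. *)
apply: (no_position dis cert (K := K) (B := B) (R := (K * K.+1).+1)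
          _ (clear_position n B) (t := K)).
- move=> D b agr hb; apply: contrapT => nF; apply: h; exists D, b; split=> //.
  by have := tot D; case: b nF {hb} => nF [].
- by split; rewrite ?add0n // value_nseq.
- by move=> D' Q _ [sQ _]; apply: leq_trans (count_size _ _) sQ.
Qed.

(** Freezing the strings shorter than [L'] freezes level [n] and the certificate of a wrong answer
    of [M], so the error persists in every later unambiguous oracle. *)
Lemma diagonal_step M (B : language) (L : nat) : NPTM M ->
  robustly_overproductive M -> robustly_underproductive M ->
  (forall n, unambiguous B n) ->
  exists B' L', [/\ forall n, unambiguous B' n, L < L',
    agree (fun s => size s < L) B' B &
    forall C, (forall n, unambiguous C n) -> agree (fun s => size s < L') C B' ->
      lang M C <> lang guesser C].
Proof.
move=> poly over under un; have [P bnd] := poly.2.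
(* [G] takes the value [(K * K.+1).+1] at [n], the budget in [decision_errs]; [L < n] keeps level
   [n], with strings of length 3n, clear of the part frozen before. *)
pose G := (P * (P + 1) + 1)%R.
have [n Ln big] := poly_lt_exp (G * ((2%N)%:P * G + (2%N)%:P))%R L.+1.
pose x := nseq n true; pose F D b := out M D x (outcome_bit b).
pose K := (P.[n])%R.
have runK D p : run (N := M) D x p -> size p <= K.
  by move/bnd; rewrite size_nseq.
have [D|D FA FR|D b FD||D [b [agr hb FD]]] := @decision_errs F K n B.
- exact: out_total.
- by apply: (under D x) => o /= [->|->].
- by have [Q] := out_certificate (runK D) FD; exists Q.
- have GE : G.[n]%R = (K * K.+1).+1.
    by rewrite /G hornerD hornerM hornerD -polyC1 hornerC -[RHS]addn1 -[K.+1]addn1.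
  by move: big; rewrite hornerM GE hornerD hornerCM GE hornerC.
have [Q sQ hQ] := out_certificate (runK D) FD.
have [m hm] : exists m, forall q, q \in Q -> size q < m.
  elim: (Q) => [|q Q' [m hm]]; first by exists 0.
  exists (m + (size q).+1) => q'; rewrite inE => /orP [/eqP ->|/hm]; lia.
exists D, (L + (3 * n + m)).+1; split.
- move=> n'; have [->|/eqP nn'] := eqVneq n' n; first by exists b.
  apply: unambiguous_agree (un n'); apply: agreeC => s [z sz e].
  by apply: agr; rewrite e => -[z' sz' /code_inj zz']; case: nn'; rewrite -sz -sz' zz'.
- by rewrite ltnS leq_addr.
- move=> s sL; apply: agr => -[z sz e]; move: sL; rewrite e size_code sz; lia.
move=> C unC agrC; have [u vu su] := violation_exists D n.
have vC : violation C u.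
  apply: violation_agree su vu => s [z sz e]; apply/esym/agrC.
  by rewrite e size_code sz; lia.
have oC : out guesser C x (outcome_bit b).
  by apply/out_violation; exists u => //; rewrite size_nseq (hb u su vu).
have MC : out M C x (outcome_bit (~~ b)).
  by apply: hQ => s /hm lt; apply: agrC; apply: leq_trans lt _; lia.
(* On [x] the guesser gives the bit [b] and [M] its negation; with equal languages one of them would
   produce both answers. *)
move=> e; have {e} eA : lang M C x = lang guesser C x by rewrite e.
rewrite /lang /mkset /= in eA.
case: b {hb FD hQ} oC MC => /= oC MC.
  apply: (under C x) => o /= [->|-> //]; by rewrite eA.
apply: (@unambiguous_underproductive C unC x) => o /= [->|-> //].
by rewrite -eA; exact: MC.
Qed.

(** * Enumeration of the machines and the limit oracle *)

(** Once its three sizes are fixed, a machine consists of finite data, so a countable dependent sum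
    covers all machines. *)
Lemma notm_countable : exists e : nat -> option notm, forall N, exists k, e k = Some N.
Proof.
pose T (d : nat * nat * nat) : countType :=
  ('I_d.1.1 * 'I_d.1.1 * 'I_d.1.1 * 'I_d.1.1 *
   {ffun 'I_d.1.1 * {ffun 'I_d.1.2.+1 -> option (bool + 'I_d.2)} ->
     {set ('I_d.1.1 + outcome) *
          {ffun 'I_d.1.2.+1 -> option (bool + 'I_d.2) * direction} * option bool}})%type.
pose decode (t : {d & T d}) : notm :=
  let: existT d (s, a, y, n, f) := t in
  @NOTM d.1.1 d.1.2 d.2 s a y n (fun q v => f (q, v)).
exists (fun k => omap decode (unpickle k)) => N.
case: N => s k m st ak ye no de.
exists (pickle (existT T (s, k, m) (st, ak, ye, no, [ffun x => de x.1 x.2]) : {d & T d})).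
rewrite pickleK /=; congr Some; congr NOTM.
by apply/funext => q; apply/funext => v; rewrite ffunE.
Qed.

Lemma diagonal_oracle : exists B, (forall n, unambiguous B n) /\
  forall M, NPTM M -> robustly_overproductive M -> robustly_underproductive M ->
    lang M B <> lang guesser B.
Proof.
have [e he] := notm_countable.
pose S := {BL : language * nat | forall n, unambiguous BL.1 n}.
pose R (kx : nat * S) (y : S) :=
  [/\ (sval kx.2).2 < (sval y).2,
    agree (fun s => size s < (sval kx.2).2) (sval y).1 (sval kx.2).1 &
    forall M, e kx.1 = Some M -> NPTM M -> robustly_overproductive M ->
      robustly_underproductive M ->
      forall C, (forall n, unambiguous C n) ->
        agree (fun s => size s < (sval y).2) C (sval y).1 ->
        lang M C <> lang guesser C].
have stepE kx : exists y, R kx y.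
  case: kx => k [[B L] /= un].
  have [[M [eM poly over under]]|no] := pselect (exists M, [/\ e k = Some M,
      NPTM M, robustly_overproductive M & robustly_underproductive M]).
    have [B' [L' [un' lt agr h]]] := diagonal_step L poly over under un.
    exists (exist _ (B', L') un'); split=> //= M'; rewrite eM => -[<-] _ _ _ C; exact: h.
  exists (exist _ (B, L.+1) un); split=> //= M eM poly over under.
  by case: no; exists M.
have [next hnext] := boolp.choice stepE.
have un0 : forall n, unambiguous (set0, 0).1 n.
  move=> n; exists false => u su; have inactive v p : ~~ active set0 v p.
    by rewrite /active; apply/negP; rewrite in_setE.
  case=> [[p _ []]|[p _ []]|[/value0 -> _]]; try by rewrite (negbTE (inactive _ _)).
  by case: (size u).
pose st := fix st k : S := if k is k'.+1 then next (k', st k') else exist _ (set0, 0) un0.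
pose B k := (sval (st k)).1; pose L k := (sval (st k)).2.
have hst k : R (k, st k) (st k.+1) by apply: hnext.
have Llt k : L k < L k.+1 by have [] := hst k.
have Lge k : k <= L k by elim: k => // k IH; apply: leq_ltn_trans IH (Llt k).
have Lmono i j : i <= j -> L i <= L j.
  elim: j => [|j IH]; first by rewrite leqn0 => /eqP ->.
  by rewrite leq_eqVlt => /orP [/eqP -> //|/IH h]; apply: leq_trans h (ltnW (Llt j)).
have agrB i j : i <= j -> agree (fun s => size s < L i) (B j) (B i).
  elim: j => [|j IH]; first by rewrite leqn0 => /eqP ->.
  rewrite leq_eqVlt => /orP [/eqP -> //|ij].
  apply: agree_trans (IH ij); have [_ agr _] := hst j.
  by apply: agree_sub agr => s h; exact: (leq_trans h (Lmono i j ij)).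
(* Since [k <= L k], a string of length l no longer changes from stage l + 1 on. *)
pose C : language := [set s | s \in B (size s).+1]%classic.
have agrC i : agree (fun s => size s < L i) C (B i).
  move=> s si; have -> : (s \in C) = (s \in B (size s).+1).
    by apply/idP/idP => [/set_mem|h] //; exact: mem_set.
  case: (leqP i (size s).+1) => h; first exact: agrB.
  by apply/esym/(agrB _ _ (ltnW h)); apply: leq_trans (Lge _).
have unC n : unambiguous C n.
  apply: unambiguous_agree (svalP (st (3 * n).+1) n) => s [z sz es].
  apply/esym/agrC; rewrite es size_code sz; exact: Lge.
exists C; split=> // M poly over under; have [k ek] := he M.
have [_ _ h] := hst k; exact: h ek poly over under C unC (agrC _).
Qed.

Theorem theorem4p8 : le_RS <> le_O.
Proof.
have [B [un h]] := diagonal_oracle.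
move=> e; have : le_O (lang guesser B, B).
  exists guesser; last exact: guesser_overproductive.
  split=> //; first exact: guesser_NPTM.
    exact: guesser_overproductive.
  exact: unambiguous_underproductive.
rewrite -e => -[M [[/= poly _ _ eq] over under]].
exact: (h M poly over under).
Qed.
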